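(* Let $\mathcal{A}$ and $\mathcal{B}$ be abelian categories and let $\mathbf{F}:\mathcal{A}\to\mathcal{B}$ be an additive and right exact functor which is perfect. Let $(\mathbf{F},\mathcal{B})$ be the left comma category. The following statements are equivalent for an object $\binom{Y}{X}_{\phi}$ in $(\mathbf{F},\mathcal{B})$ (so $Y\in\mathcal{A}$, $X\in\mathcal{B}$ and $\phi:\mathbf{F}Y\to X$ is a morphism in $\mathcal{B}$). (1) $\binom{Y}{X}_{\phi}\in\mathcal{GP}((\mathbf{F},\mathcal{B}))$. (2) $\phi:\mathbf{F}Y\to X$ is injective (that is, a monomorphism) in $\mathcal{B}$, $\operatorname{Coker}\phi\in\mathcal{GP}(\mathcal{B})$ and $Y\in\mathcal{GP}(\mathcal{A})$.
   Context: Left comma category: for an additive functor $\mathbf{F}:\mathcal{A}\to\mathcal{B}$ between abelian categories, the objects of $(\mathbf{F},\mathcal{B})$ are $\binom{A}{B}_{\phi}$ with $A\in\mathcal{A}$, $B\in\mathcal{B}$ and $\phi\in\operatorname{Hom}_{\mathcal{B}}(\mathbf{F}A,B)$; a morphism $\binom{A}{B}_{\phi}\to\binom{A'}{B'}_{\phi'}$ is a pair $\binom{\alpha}{\beta}$ with $\alpha:A\to A'$ in $\mathcal{A}$, $\beta:B\to B'$ in $\mathcal{B}$ and $\beta\phi=\phi'\,\mathbf{F}(\alpha)$. If $\mathbf{F}$ is right exact, $(\mathbf{F},\mathcal{B})$ is abelian. Gorenstein projective objects: for an abelian category $\mathcal{C}$, $\mathcal{P}(\mathcal{C})$ is the full subcategory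 of projective objects. A complete $\mathcal{C}$-projective resolution is an exact sequence $\cdots\to Q_1\to Q_0\to Q^0\to Q^1\to\cdots$ of projective objects of $\mathcal{C}$ that remains exact after applying $\operatorname{Hom}_{\mathcal{C}}(-,P)$ for every $P\in\mathcal{P}(\mathcal{C})$. An object $G$ is Gorenstein projective if $G\cong\operatorname{Im}(Q_0\to Q^0)$ for some such sequence. $\mathcal{GP}(\mathcal{C})$ is the full subcategory of Gorenstein projective objects. Perfect functor: $\mathbf{F}$ is perfect if (P1) for every exact sequence $Q^{\bullet}$ of projective objects in $\mathcal{A}$, $\mathbf{F}Q^{\bullet}$ is exact; and (P2) for every complete $\mathcal{B}$-projective resolution $P^{\bullet}$ and every $Q\in\mathcal{P}(\mathcal{A})$, $\operatorname{Hom}_{\mathcal{B}}(P^{\bullet},\mathbf{F}Q)$ is exact. *)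

(* Defs.v *)
From HB Require Import structures.
From mathcomp Require Import all_boot all_order all_algebra.

Set Implicit Arguments.
Unset Strict Implicit.
Unset Printing Implicit Defensive.

Import GRing.Theory.
Local Open Scope ring_scope.

Reserved Notation "g \oc f" (at level 40, left associativity).

(* Kernels, cokernels, images and exactness are given by their universal
   properties (they are determined up to isomorphism), so they make sense in
   any preadditive category; their existence is part of [is_abelian]. *)

Record preadditive_category := Preadditive {
  obj :> Type;
  mor : obj -> obj -> zmodType;
  idm : forall X, mor X X;
  mcomp : forall X Y Z, mor Y Z -> mor X Y -> mor X Z;
  mcomp1m : forall X Y (f : mor X Y), mcomp (idm Y) f = f;
  mcompm1 : forall X Y (f : mor X Y), mcomp f (idm X) = f;
  mcompA : forall X Y Z T (h : mor Z T) (g : mor Y Z) (f : mor X Y),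
    mcomp h (mcomp g f) = mcomp (mcomp h g) f;
  mcompDl : forall X Y Z (g g' : mor Y Z) (f : mor X Y),
    mcomp (g + g') f = mcomp g f + mcomp g' f;
  mcompDr : forall X Y Z (g : mor Y Z) (f f' : mor X Y),
    mcomp g (f + f') = mcomp g f + mcomp g f'
}.

Arguments mor {p} X Y : rename.
Arguments idm {p} X : rename.
Arguments mcomp {p X Y Z} g f : rename.

Notation "g \oc f" := (mcomp g f).

Section Notions.
Variable C : preadditive_category.
Implicit Types X Y Z : C.

Definition is_mono X Y (f : mor X Y) :=
  forall T (g h : mor T X), f \oc g = f \oc h -> g = h.

Definition is_epi X Y (f : mor X Y) :=
  forall T (g h : mor Y T), g \oc f = h \oc f -> g = h.

Definition isomorphic X Y :=
  exists (f : mor X Y) (g : mor Y X), g \oc f = idm X /\ f \oc g = idm Y.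

Definition is_zero Z :=
  forall X, (forall f : mor X Z, f = 0) /\ (forall f : mor Z X, f = 0).

Definition is_biproduct X Y P (i1 : mor X P) (i2 : mor Y P)
    (p1 : mor P X) (p2 : mor P Y) :=
  [/\ p1 \oc i1 = idm X, p2 \oc i2 = idm Y, p2 \oc i1 = 0, p1 \oc i2 = 0
    & i1 \oc p1 + i2 \oc p2 = idm P].

Definition is_kernel X Y (f : mor X Y) K (k : mor K X) :=
  f \oc k = 0 /\
  forall T (t : mor T X), f \oc t = 0 -> exists! u : mor T K, k \oc u = t.

Definition is_cokernel X Y (f : mor X Y) K (c : mor Y K) :=
  c \oc f = 0 /\
  forall T (t : mor Y T), t \oc f = 0 -> exists! u : mor K T, u \oc c = t.

Record is_abelian : Prop := IsAbelian {
  ab_zero : exists Z : C, is_zero Z;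
  ab_biproduct : forall X Y, exists P i1 i2 p1 p2,
    @is_biproduct X Y P i1 i2 p1 p2;
  ab_kernel : forall X Y (f : mor X Y), exists K (k : mor K X), is_kernel f k;
  ab_cokernel : forall X Y (f : mor X Y),
    exists K (c : mor Y K), is_cokernel f c;
  ab_mono : forall X Y (f : mor X Y), is_mono f ->
    exists Z (h : mor Y Z), is_kernel h f;
  ab_epi : forall X Y (f : mor X Y), is_epi f ->
    exists Z (h : mor Z X), is_cokernel h f
}.

(* Im f = Ker (Coker f) *)
Definition is_image X Y (f : mor X Y) I (m : mor I Y) :=
  exists K (c : mor Y K), is_cokernel f c /\ is_kernel c m.

(* Im f = Ker g as subobjects of Y *)
Definition exact X Y Z (f : mor X Y) (g : mor Y Z) :=
  exists I (m : mor I Y), is_image f m /\ is_kernel g m.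

Definition is_projective P :=
  forall X Y (e : mor X Y), is_epi e ->
  forall f : mor P Y, exists g : mor P X, e \oc g = f.

(* Z-indexed sequences  ... -> Q (-1) -> Q 0 -> Q 1 -> ... *)
Record sequence := Sequence {
  seq_term :> int -> C;
  seq_diff : forall n : int, mor (seq_term n) (seq_term (n + 1))
}.

Definition exact_sequence (Q : sequence) :=
  forall n : int, exact (seq_diff Q n) (seq_diff Q (n + 1)).

(* Exactness of the sequence of abelian groups
     Hom (Q (n+2), T) -> Hom (Q (n+1), T) -> Hom (Q n, T), n in Z. *)
Definition hom_exact (Q : sequence) (T : C) :=
  forall (n : int) (g : mor (Q (n + 1)) T),
    g \oc seq_diff Q n = 0 <->
    exists h : mor (Q (n + 1 + 1)) T, h \oc seq_diff Q (n + 1) = g.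

Definition complete_resolution (Q : sequence) :=
  [/\ forall n, is_projective (Q n),
      exact_sequence Q
    & forall P, is_projective P -> hom_exact Q P].

(* With Q_i at index -(i+1) and Q^i at index i, the map Q_0 -> Q^0 is the
   differential at index -1. *)
Definition gorenstein_projective (G : C) :=
  exists Q, complete_resolution Q /\
  exists I (m : mor I (Q (-1 + 1))),
    is_image (seq_diff Q (-1)) m /\ isomorphic G I.

End Notions.

Record abelian_category := Abelian {
  ab_cat :> preadditive_category;
  abelianP : is_abelian ab_cat
}.

Record additive_functor (A B : preadditive_category) := AdditiveFunctor {
  fobj :> A -> B;
  fmap : forall X Y, mor X Y -> mor (fobj X) (fobj Y);
  fmap1 : forall X, fmap (idm X) = idm (fobj X);
  fmap_comp : forall X Y Z (g : mor Y Z) (f : mor X Y),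
    fmap (g \oc f) = fmap g \oc fmap f;
  fmapD : forall X Y (f g : mor X Y), fmap (f + g) = fmap f + fmap g
}.

Arguments fmap {A B} F {X Y} f : rename.

Section Functors.
Variables (A B : preadditive_category) (F : additive_functor A B).

(* X -> Y -> Z -> 0 exact implies FX -> FY -> FZ -> 0 exact *)
Definition right_exact :=
  forall X Y Z (f : mor X Y) (g : mor Y Z),
    exact f g -> is_epi g -> exact (fmap F f) (fmap F g) /\ is_epi (fmap F g).

Definition fseq (Q : sequence A) : sequence B :=
  Sequence (fun n => fmap F (seq_diff Q n)).

Definition perfect :=
  (forall Q : sequence A, (forall n, is_projective (Q n)) ->
     exact_sequence Q -> exact_sequence (fseq Q)) /\
  (forall P : sequence B, complete_resolution P ->
     forall Q : A, is_projective Q -> hom_exact P (F Q)).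

End Functors.

Section PreadditiveTheory.
Variable C : preadditive_category.
Implicit Types X Y Z : C.

Lemma mcomp0m X Y Z (f : mor X Y) : (0 : mor Y Z) \oc f = 0.
Proof. by apply: (addrI (0 \oc f)); rewrite -mcompDl !addr0. Qed.

Lemma mcompm0 X Y Z (g : mor Y Z) : g \oc (0 : mor X Y) = 0.
Proof. by apply: (addrI (g \oc 0)); rewrite -mcompDr !addr0. Qed.

Lemma mcompNm X Y Z (g : mor Y Z) (f : mor X Y) : (- g) \oc f = - (g \oc f).
Proof. by apply: (addrI (g \oc f)); rewrite -mcompDl !subrr mcomp0m. Qed.

Lemma mcompmN X Y Z (g : mor Y Z) (f : mor X Y) : g \oc (- f) = - (g \oc f).
Proof. by apply: (addrI (g \oc f)); rewrite -mcompDr !subrr mcompm0. Qed.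

Lemma mcompBl X Y Z (g g' : mor Y Z) (f : mor X Y) :
  (g - g') \oc f = g \oc f - g' \oc f.
Proof. by rewrite mcompDl mcompNm. Qed.

Lemma mcompBr X Y Z (g : mor Y Z) (f f' : mor X Y) :
  g \oc (f - f') = g \oc f - g \oc f'.
Proof. by rewrite mcompDr mcompmN. Qed.

Lemma monoP X Y (f : mor X Y) :
  is_mono f <-> forall T (g : mor T X), f \oc g = 0 -> g = 0.
Proof.
split=> [mf T g fg0|mf T g h fgh]; first by apply: mf; rewrite mcompm0.
by apply/eqP; rewrite -subr_eq0; apply/eqP/mf; rewrite mcompBr fgh subrr.
Qed.

Lemma epiP X Y (f : mor X Y) :
  is_epi f <-> forall T (g : mor Y T), g \oc f = 0 -> g = 0.
Proof.
split=> [ef T g fg0|ef T g h fgh]; first by apply: ef; rewrite mcomp0m.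
by apply/eqP; rewrite -subr_eq0; apply/eqP/ef; rewrite mcompBl fgh subrr.
Qed.

Lemma kernel_mono X Y (f : mor X Y) K (k : mor K X) :
  is_kernel f k -> is_mono k.
Proof.
case=> fk uk; apply/monoP => T g kg0.
have [|u [_ uu]] := uk T 0; first by rewrite mcompm0.
by rewrite -(uu g) // -(uu 0) // mcompm0.
Qed.

Lemma cokernel_epi X Y (f : mor X Y) K (c : mor Y K) :
  is_cokernel f c -> is_epi c.
Proof.
case=> fk uk; apply/epiP => T g kg0.
have [|u [_ uu]] := uk T 0; first by rewrite mcomp0m.
by rewrite -(uu g) // -(uu 0) // mcomp0m.
Qed.

Lemma is_kernelP X Y (f : mor X Y) K (k : mor K X) :
  is_kernel f k <-> [/\ f \oc k = 0, is_mono k &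
    forall T (t : mor T X), f \oc t = 0 -> exists u : mor T K, k \oc u = t].
Proof.
split=> [kk|[fk mk uk]].
  split; [by case: kk | exact: kernel_mono kk|].
  by move=> T t /(proj2 kk)[u [ku _]]; exists u.
split=> // T t /uk[u ku]; exists u; split=> // v kv.
by apply: mk; rewrite ku kv.
Qed.

Lemma is_cokernelP X Y (f : mor X Y) K (c : mor Y K) :
  is_cokernel f c <-> [/\ c \oc f = 0, is_epi c &
    forall T (t : mor Y T), t \oc f = 0 -> exists u : mor K T, u \oc c = t].
Proof.
split=> [kk|[fk mk uk]].
  split; [by case: kk | exact: cokernel_epi kk|].
  by move=> T t /(proj2 kk)[u [ku _]]; exists u.
split=> // T t /uk[u ku]; exists u; split=> // v kv.
by apply: mk; rewrite ku kv.
Qed.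

End PreadditiveTheory.

Section AbelianTheory.
Variables (C : preadditive_category) (abC : is_abelian C).
Implicit Types X Y Z : C.

Lemma mono_kernel_coker X Y (f : mor X Y) K (c : mor Y K) :
  is_mono f -> is_cokernel f c -> is_kernel c f.
Proof.
move=> mf /is_cokernelP[cf ec uc].
have [Z [h /is_kernelP[hf _ uh]]] := ab_mono abC mf.
apply/is_kernelP; split=> // T t ct; apply: uh.
by have [u <-] := uc _ h hf; rewrite -mcompA ct mcompm0.
Qed.

Lemma epi_coker_kernel X Y (f : mor X Y) K (k : mor K X) :
  is_epi f -> is_kernel f k -> is_cokernel k f.
Proof.
move=> ef /is_kernelP[fk mk uk].
have [Z [h /is_cokernelP[fh _ uh]]] := ab_epi abC ef.
apply/is_cokernelP; split=> // T t tk; apply: uh.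
by have [u <-] := uk _ h fh; rewrite mcompA tk mcomp0m.
Qed.

Lemma cokernel_exact X Y (f : mor X Y) K (c : mor Y K) :
  is_cokernel f c -> exact f c.
Proof.
move=> cc; have [I [m mk]] := ab_kernel abC c.
by exists I, m; split=> //; exists K, c.
Qed.

Lemma exact_epi_cokernel X Y Z (f : mor X Y) (g : mor Y Z) :
  exact f g -> is_epi g -> is_cokernel f g.
Proof.
move=> [I [m [[K [c [cc km]]] kg]]] eg.
have /is_cokernelP[gm _ ug] := epi_coker_kernel eg kg.
have ec := cokernel_epi cc.
have /is_cokernelP[cm _ uc] := epi_coker_kernel ec km.
case/is_cokernelP: cc => cf _ ucf.
apply/is_cokernelP; split=> //.
  by have [u <-] := uc _ _ gm; rewrite -mcompA cf mcompm0.
move=> T t /ucf[u <-]; have [v <-] := ug _ _ cm.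
by exists (u \oc v); rewrite mcompA.
Qed.

End AbelianTheory.

Section Comma.
Variables (A B : preadditive_category) (F : additive_functor A B).

Lemma fmap0 X Y : fmap F (0 : mor X Y) = 0.
Proof. by apply: (addrI (fmap F 0)); rewrite -fmapD !addr0. Qed.

Lemma fmapN X Y (f : mor X Y) : fmap F (- f) = - fmap F f.
Proof. by apply: (addrI (fmap F f)); rewrite -fmapD !subrr fmap0. Qed.

Record comma_obj := CommaObj {
  ctop : A;
  cbot : B;
  cmap : mor (F ctop) cbot
}.

Section CommaHom.
Variables M N : comma_obj.

Definition comma_square (p : mor (ctop M) (ctop N) * mor (cbot M) (cbot N)) :=
  p.2 \oc cmap M == cmap N \oc fmap F p.1.

Record comma_hom := CommaHom {
  comma_pair : mor (ctop M) (ctop N) * mor (cbot M) (cbot N);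
  comma_pairP : comma_square comma_pair
}.

Fact comma_square_zmod_closed : zmod_closed comma_square.
Proof.
split; rewrite ?unfold_in /comma_square /= ?fmap0 ?mcomp0m ?mcompm0 //.
move=> [a b] [a' b']; rewrite !unfold_in /comma_square /= => /eqP e /eqP e'.
by rewrite mcompBl fmapD fmapN mcompBr e e'.
Qed.

HB.instance Definition _ :=
  GRing.isZmodClosed.Build _ comma_square comma_square_zmod_closed.
HB.instance Definition _ := [isSub for comma_pair].
HB.instance Definition _ := [Choice of comma_hom by <:].
HB.instance Definition _ := [SubChoice_isSubZmodule of comma_hom by <:].

End CommaHom.

Fact comma_id_square M : @comma_square M M (idm _, idm _).
Proof. by rewrite /comma_square /= fmap1 mcomp1m mcompm1. Qed.

Definition comma_id M := CommaHom (comma_id_square M).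

Fact comma_comp_square M N P (g : comma_hom N P) (f : comma_hom M N) :
  @comma_square M P ((comma_pair g).1 \oc (comma_pair f).1,
                     (comma_pair g).2 \oc (comma_pair f).2).
Proof.
case: g f => [[g1 g2] /eqP /= eg] [[f1 f2] /eqP /= ef].
by rewrite /comma_square /= -mcompA ef mcompA eg -mcompA fmap_comp.
Qed.

Definition comma_comp M N P (g : comma_hom N P) (f : comma_hom M N) :=
  CommaHom (comma_comp_square g f).

Lemma comma_hom_eq M N (f g : comma_hom M N) :
  (comma_pair f).1 = (comma_pair g).1 -> (comma_pair f).2 = (comma_pair g).2 ->
  f = g.
Proof.
move=> e1 e2; apply: val_inj => /=.
by rewrite [LHS]surjective_pairing [RHS]surjective_pairing e1 e2.
Qed.

Definition comma : preadditive_category.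
Proof.
refine (@Preadditive comma_obj (fun M N => comma_hom M N : zmodType)
  comma_id comma_comp _ _ _ _ _).
- by move=> *; apply: comma_hom_eq; rewrite /= mcomp1m.
- by move=> *; apply: comma_hom_eq; rewrite /= mcompm1.
- by move=> *; apply: comma_hom_eq; rewrite /= mcompA.
- by move=> *; apply: comma_hom_eq; rewrite /= mcompDl.
- by move=> *; apply: comma_hom_eq; rewrite /= mcompDr.
Defined.

Definition Comma (Y : A) (X : B) (phi : mor (F Y) X) : comma := CommaObj phi.

Definition comma_homI (M N : comma_obj) a b
  (e : b \oc cmap M = cmap N \oc fmap F a) : @mor comma M N :=
  @CommaHom M N (a, b) (introT eqP e).

Definition comma_top (M N : comma) (f : mor M N) : mor (ctop M) (ctop N) :=
  (comma_pair f).1.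
Definition comma_bot (M N : comma) (f : mor M N) : mor (cbot M) (cbot N) :=
  (comma_pair f).2.

Lemma comma_homE (M N : comma) (f : mor M N) :
  comma_bot f \oc cmap M = cmap N \oc fmap F (comma_top f).
Proof. exact: (eqP (comma_pairP f)). Qed.

Lemma comma_hom0 (M N : comma) (f : mor M N) :
  f = 0 <-> comma_top f = 0 /\ comma_bot f = 0.
Proof. by split=> [->//|[t0 b0]]; apply: comma_hom_eq. Qed.

Hypotheses (abA : is_abelian A) (abB : is_abelian B) (rF : right_exact F).

Lemma right_exact_cokernel X Y (f : mor X Y) K (c : mor Y K) :
  is_cokernel f c -> is_cokernel (fmap F f) (fmap F c).
Proof.
move=> cc; have [|ex ep] := rF (cokernel_exact abA cc);
  first exact: cokernel_epi cc.
exact: exact_epi_cokernel.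
Qed.

Lemma comma_kernel (P M N : comma) (f : mor M N) (k : mor P M) :
  is_kernel (comma_top f) (comma_top k) -> is_kernel (comma_bot f) (comma_bot k) ->
  is_kernel f k.
Proof.
move=> /is_kernelP[fk mk uk] /is_kernelP[fl ml ul]; apply/is_kernelP; split.
- by apply/comma_hom0.
- move=> T g h egh; apply: comma_hom_eq.
    by apply: mk; apply: (congr1 (@comma_top _ _) egh).
  by apply: ml; apply: (congr1 (@comma_bot _ _) egh).
move=> T t ft.
have [|u ku] := uk _ (comma_top t); first exact: (congr1 (@comma_top _ _) ft).
have [|v lv] := ul _ (comma_bot t); first exact: (congr1 (@comma_bot _ _) ft).
have euv : v \oc cmap T = cmap P \oc fmap F u.
  by apply: ml; rewrite !mcompA lv !comma_homE -mcompA -fmap_comp ku.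
by exists (@comma_homI T P u v euv); apply: comma_hom_eq.
Qed.

Lemma comma_cokernel (M N P : comma) (f : mor M N) (k : mor N P) :
  is_cokernel (comma_top f) (comma_top k) ->
  is_cokernel (comma_bot f) (comma_bot k) -> is_cokernel f k.
Proof.
move=> ck cl; have /is_cokernelP[_ Fmk _] := right_exact_cokernel ck.
have /is_cokernelP[fk mk uk] := ck; have /is_cokernelP[fl ml ul] := cl.
apply/is_cokernelP; split.
- by apply/comma_hom0.
- move=> T g h egh; apply: comma_hom_eq.
    by apply: mk; apply: (congr1 (@comma_top _ _) egh).
  by apply: ml; apply: (congr1 (@comma_bot _ _) egh).
move=> T t ft.
have [|u ku] := uk _ (comma_top t); first exact: (congr1 (@comma_top _ _) ft).
have [|v lv] := ul _ (comma_bot t); first exact: (congr1 (@comma_bot _ _) ft).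
have euv : v \oc cmap P = cmap T \oc fmap F u.
  by apply: Fmk; rewrite -!mcompA -comma_homE mcompA lv comma_homE -fmap_comp ku.
by exists (@comma_homI P T u v euv); apply: comma_hom_eq.
Qed.

Lemma comma_kernel_ex (M N : comma) (f : mor M N) : exists P (k : mor P M),
  is_kernel (comma_top f) (comma_top k) /\
  is_kernel (comma_bot f) (comma_bot k).
Proof.
have [KA [k kk]] := ab_kernel abA (comma_top f).
have [KB [l kl]] := ab_kernel abB (comma_bot f).
have /is_kernelP[fk _ _] := kk; have /is_kernelP[_ _ ul] := kl.
have [|K e] := ul _ (cmap M \oc fmap F k).
  by rewrite mcompA comma_homE -mcompA -fmap_comp fk fmap0 mcompm0.
by exists (CommaObj K), (@comma_homI (CommaObj K) M k l e).
Qed.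

Lemma comma_cokernel_ex (M N : comma) (f : mor M N) : exists P (k : mor N P),
  is_cokernel (comma_top f) (comma_top k) /\
  is_cokernel (comma_bot f) (comma_bot k).
Proof.
have [KA [k kk]] := ab_cokernel abA (comma_top f).
have [KB [l kl]] := ab_cokernel abB (comma_bot f).
have /is_cokernelP[_ _ Fuk] := right_exact_cokernel kk.
have /is_cokernelP[fl _ _] := kl.
have [|K e] := Fuk _ (l \oc cmap N).
  by rewrite -mcompA -comma_homE mcompA fl mcomp0m.
by exists (CommaObj K), (@comma_homI N (CommaObj K) k l (esym e)).
Qed.

Lemma comma_mono_sub (M N : comma) (f : mor M N) :
  is_mono f -> is_mono (comma_top f) /\ is_mono (comma_bot f).
Proof.
move=> mf; have [P [k [kA kB]]] := comma_kernel_ex f.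
have /comma_hom0[k0 l0] := (monoP f).1 mf _ _ (proj1 (comma_kernel kA kB)).
split; apply/monoP => T t ft.
  by case/is_kernelP: kA => _ _ /(_ T t ft)[u <-]; rewrite k0 mcomp0m.
by case/is_kernelP: kB => _ _ /(_ T t ft)[u <-]; rewrite l0 mcomp0m.
Qed.

Lemma comma_epi_sub (M N : comma) (f : mor M N) :
  is_epi f -> is_epi (comma_top f) /\ is_epi (comma_bot f).
Proof.
move=> ef; have [P [k [kA kB]]] := comma_cokernel_ex f.
have /comma_hom0[k0 l0] := (epiP f).1 ef _ _ (proj1 (comma_cokernel kA kB)).
split; apply/epiP => T t ft.
  by case/is_cokernelP: kA => _ _ /(_ T t ft)[u <-]; rewrite k0 mcompm0.
by case/is_cokernelP: kB => _ _ /(_ T t ft)[u <-]; rewrite l0 mcompm0.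
Qed.

Theorem comma_is_abelian : is_abelian comma.
Proof.
split.
- have [ZA zA] := ab_zero abA; have [ZB zB] := ab_zero abB.
  exists (@CommaObj ZA ZB 0) => M.
  by split=> f; apply/comma_hom0; split; [apply (zA _) | apply (zB _)
     | apply (zA _) | apply (zB _)].
- move=> M N.
  have [P [i1 [i2 [p1 [p2 [A1 A2 A3 A4 A5]]]]]] :=
    ab_biproduct abA (ctop M) (ctop N).
  have [R [j1 [j2 [q1 [q2 [B1 B2 B3 B4 B5]]]]]] :=
    ab_biproduct abB (cbot M) (cbot N).
  pose W := CommaObj (j1 \oc cmap M \oc fmap F p1 + j2 \oc cmap N \oc fmap F p2).
  have ei1 : j1 \oc cmap M = cmap W \oc fmap F i1.
    rewrite /= mcompDl -!(mcompA _ (fmap F _) (fmap F _)) -!fmap_comp A1 A3 fmap1.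
    by rewrite fmap0 mcompm0 mcompm1 addr0.
  have ei2 : j2 \oc cmap N = cmap W \oc fmap F i2.
    rewrite /= mcompDl -!(mcompA _ (fmap F _) (fmap F _)) -!fmap_comp A2 A4 fmap1.
    by rewrite fmap0 mcompm0 mcompm1 add0r.
  have ep1 : q1 \oc cmap W = cmap M \oc fmap F p1.
    by rewrite /= mcompDr !mcompA B1 B4 !mcomp0m mcomp1m addr0.
  have ep2 : q2 \oc cmap W = cmap N \oc fmap F p2.
    by rewrite /= mcompDr !mcompA B2 B3 !mcomp0m mcomp1m add0r.
  exists W, (@comma_homI M W i1 j1 ei1), (@comma_homI N W i2 j2 ei2),
    (@comma_homI W M p1 q1 ep1), (@comma_homI W N p2 q2 ep2).
  by split; apply: comma_hom_eq.
- move=> M N f; have [P [k [kA kB]]] := comma_kernel_ex f.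
  by exists P, k; apply: comma_kernel.
- move=> M N f; have [P [k [kA kB]]] := comma_cokernel_ex f.
  by exists P, k; apply: comma_cokernel.
- move=> M N f /comma_mono_sub[mA mB]; have [P [c [cA cB]]] := comma_cokernel_ex f.
  by exists P, c; apply: comma_kernel; apply: mono_kernel_coker.
- move=> M N f /comma_epi_sub[eA eB]; have [P [k [kA kB]]] := comma_kernel_ex f.
  by exists P, k; apply: comma_cokernel; apply: epi_coker_kernel.
Qed.

End Comma.

(* Main.v *)
(* A class [W] of objects each of which is both a quotient of a
   projective with kernel in [W] and a subobject of a projective with quotient
   in [W], and on which [Ext^1 (-, P)] vanishes
   for projective [P], consists of Gorenstein projective objects: the short
   exact sequences splice into a complete resolution.  Everything is therefore
   reduced to one short exact sequence at a time.

   (1) => (2): a projective of the comma category is [(Q, FQ (+) P)] with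
   [Q, P] projective.  Given a short exact sequence [M' -> (Q, FQ (+) P) -> M]
   of Gorenstein projectives, (P1) makes the functor exact on its top row, so
   the structure maps are monomorphisms and the cokernels form a short exact
   sequence with projective middle term [P].  Homs into [(0, P)] give the Ext
   condition for the cokernels; then (P2) gives [Ext^1 (Coker phi, FQ) = 0] and
   homs into [(Q, FQ)] give the Ext condition for the tops.

   (2) => (1): the class of objects satisfying (2) is closed under the two
   steps by a horseshoe construction with middle term [(Q, FQ (+) P)]; the
   embedding [FY -> FQ] extends to [X] because [Ext^1 (Coker phi, FQ) = 0]. *)

Require Import Defs.
From mathcomp Require Import all_boot all_order all_algebra.
From Stdlib Require Import ClassicalEpsilon.

Set Implicit Arguments.
Unset Strict Implicit.
Unset Printing Implicit Defensive.

Import GRing.Theory.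
Local Open Scope ring_scope.

(** * Short exact sequences and vanishing of [Ext^1] *)

Definition short_exact (C : preadditive_category) (X Y Z : C)
    (i : mor X Y) (p : mor Y Z) :=
  is_kernel p i /\ is_cokernel i p.

(** This is [Ext^1 (G, T) = 0] without Ext groups; with [f] the identity of [U = T] it splits every
    extension of [G] by [T]. *)
Definition ext_vanish (C : preadditive_category) (G T : C) :=
  forall (U X : C) (u : mor U X) (v : mor X G), short_exact u v ->
  forall f : mor U T, exists g : mor X T, g \oc u = f.

(** * Diagram chasing in an abelian category *)

Section Abelian.
Variables (C : preadditive_category) (abC : is_abelian C).
Implicit Types X Y Z T G Q : C.

Lemma compA X Y Z (f : mor X Y) (g : mor Y Z) (h : mor X Z) :
  g \oc f = h -> forall T (x : mor T X), g \oc (f \oc x) = h \oc x.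
Proof. by move=> <- T x; rewrite mcompA. Qed.

Lemma mono_comp X Y Z (g : mor Y Z) (f : mor X Y) :
  is_mono g -> is_mono f -> is_mono (g \oc f).
Proof. by move=> mg mf T a b; rewrite -!mcompA => /mg /mf. Qed.

Lemma mono_compr X Y Z (g : mor Y Z) (f : mor X Y) :
  is_mono (g \oc f) -> is_mono f.
Proof. by move=> m T a b e; apply: m; rewrite -!mcompA e. Qed.

Lemma epi_comp X Y Z (g : mor Y Z) (f : mor X Y) :
  is_epi g -> is_epi f -> is_epi (g \oc f).
Proof. by move=> eg ef T a b; rewrite !mcompA => /ef /eg. Qed.

Lemma epi_compl X Y Z (g : mor Y Z) (f : mor X Y) :
  is_epi (g \oc f) -> is_epi g.
Proof. by move=> m T a b e; apply: m; rewrite !mcompA e. Qed.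

Lemma id_mono X : is_mono (idm X).
Proof. by move=> T g h; rewrite !mcomp1m. Qed.

Lemma split_mono X Y (f : mor X Y) (g : mor Y X) :
  g \oc f = idm X -> is_mono f.
Proof. by move=> e; apply: (@mono_compr _ _ _ g); rewrite e; apply: id_mono. Qed.

Lemma split_epi X Y (f : mor X Y) (g : mor Y X) :
  g \oc f = idm X -> is_epi g.
Proof.
move=> e; apply: (@epi_compl _ _ _ _ f); rewrite e.
by move=> T a b; rewrite !mcompm1.
Qed.

Lemma epi_cokernel_comp X Y Z T (c : mor Y Z) (f : mor X Y) (e : mor T X) :
  is_epi e -> is_cokernel (f \oc e) c <-> is_cokernel f c.
Proof.
move=> ee; split=> /is_cokernelP[cf ec uc]; apply/is_cokernelP; split=> //.
- by apply: ee; rewrite mcomp0m -mcompA cf.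
- by move=> W t tf; apply: uc; rewrite mcompA tf mcomp0m.
- by rewrite mcompA cf mcomp0m.
- by move=> W t; rewrite mcompA => tf; apply/uc/ee; rewrite tf mcomp0m.
Qed.

Lemma kernel_iso X Y (f : mor X Y) K (k : mor K X) K' (k' : mor K' X) :
  is_kernel f k -> is_kernel f k' ->
  exists a b, [/\ b \oc a = idm K, a \oc b = idm K', k' \oc a = k & k \oc b = k'].
Proof.
move=> /is_kernelP[fk mk uk] /is_kernelP[fk' mk' uk'].
have [a ea] := uk' _ _ fk; have [b eb] := uk _ _ fk'.
exists a, b; split=> //.
  by apply: mk; rewrite mcompA eb ea mcompm1.
by apply: mk'; rewrite mcompA ea eb mcompm1.
Qed.

Lemma cokernel_iso X Y (f : mor X Y) K (k : mor Y K) K' (k' : mor Y K') :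
  is_cokernel f k -> is_cokernel f k' ->
  exists a b, [/\ b \oc a = idm K, a \oc b = idm K', a \oc k = k' & b \oc k' = k].
Proof.
move=> /is_cokernelP[fk mk uk] /is_cokernelP[fk' mk' uk'].
have [a ea] := uk _ _ fk'; have [b eb] := uk' _ _ fk.
exists a, b; split=> //.
  by apply: mk; rewrite -mcompA ea eb mcomp1m.
by apply: mk'; rewrite -mcompA eb ea mcomp1m.
Qed.

Lemma kernel_transport X Y (f : mor X Y) K (k : mor K X) K' (a : mor K K')
    (b : mor K' K) (k' : mor K' X) :
  b \oc a = idm K -> a \oc b = idm K' -> k \oc b = k' -> is_kernel f k ->
  is_kernel f k'.
Proof.
move=> ba ab <- /is_kernelP[fk mk uk]; apply/is_kernelP; split.
- by rewrite mcompA fk mcomp0m.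
- by apply: mono_comp => //; apply: split_mono ab.
- move=> T t /uk[s <-]; exists (a \oc s).
  by rewrite -mcompA (mcompA b) ba mcomp1m.
Qed.

Lemma cokernel_transport X Y (f : mor X Y) K (k : mor Y K) K' (a : mor K K')
    (b : mor K' K) (k' : mor Y K') :
  b \oc a = idm K -> a \oc b = idm K' -> a \oc k = k' -> is_cokernel f k ->
  is_cokernel f k'.
Proof.
move=> ba ab <- /is_cokernelP[fk mk uk]; apply/is_cokernelP; split.
- by rewrite -mcompA fk mcompm0.
- by apply: epi_comp => //; apply: split_epi ab.
- move=> T t /uk[s <-]; exists (s \oc b).
  by rewrite -mcompA (mcompA b) ba mcomp1m.
Qed.

(* Epimorphisms are stable under pullback, so generalized elements [T -> X]
   can be lifted along them after refining [T]; the diagram chases below use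
   such refinements. *)
Lemma epi_refine X Z (f : mor X Z) T (t : mor T Z) : is_epi f ->
  exists T' (e : mor T' T) (s : mor T' X), is_epi e /\ f \oc s = t \oc e.
Proof.
move=> ef; have [S [i1 [i2 [p1 [p2 [e11 e22 e21 e12 _]]]]]] :=
  ab_biproduct abC X T.
(* The pullback of [f] and [t] is the kernel of [h]; its projection to [T] is epi because [h], being
   epi, is the cokernel of that kernel. *)
pose h := f \oc p1 - t \oc p2.
have hi1 : h \oc i1 = f by rewrite mcompBl -!mcompA e11 e21 mcompm1 mcompm0 subr0.
have eh : is_epi h by apply: (@epi_compl _ _ _ _ i1); rewrite hi1.
have [P [k kk]] := ab_kernel abC h.
exists P, (p2 \oc k), (p1 \oc k); split.
  apply/epiP => W u uk.
  have /is_cokernelP[_ _ uh] := epi_coker_kernel abC eh kk.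
  have [|w ew] := uh _ (u \oc p2); first by rewrite -mcompA.
  have w0 : w = 0.
    by apply: ef; rewrite mcomp0m -hi1 mcompA ew -mcompA e21 mcompm0.
  by rewrite -(mcompm1 u) -e22 mcompA -ew w0 !mcomp0m.
by apply/eqP; rewrite -subr_eq0 !mcompA -mcompBl; apply/eqP; case: kk.
Qed.

Lemma mono_descend X Y (k : mor X Y) T (t : mor T Y) T' (e : mor T' T)
    (s : mor T' X) :
  is_mono k -> is_epi e -> k \oc s = t \oc e -> exists s', k \oc s' = t.
Proof.
move=> mk ee es; have [K [c cc]] := ab_cokernel abC k.
have /is_kernelP[ck _ uc] := mono_kernel_coker abC mk cc.
by apply: uc; apply: ee; rewrite -mcompA -es mcompA ck !mcomp0m.
Qed.

(** If [u] kills [e], then [f] factors through [m \oc n] with [n] the kernel of [u]; since [c] is a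
    cokernel of [f], so does [m], which makes [n] split epi and [u] zero. *)
Lemma image_factor X Y (f : mor X Y) I (m : mor I Y) : is_image f m ->
  exists e : mor X I, is_epi e /\ m \oc e = f.
Proof.
case=> K [c [/is_cokernelP[cf ec uc] /is_kernelP[cm mm um]]].
have [e ef] := um _ _ cf; exists e; split=> //.
apply/epiP => T u ue.
have [N [n /is_kernelP[un mn uun]]] := ab_kernel abC u.
have [e' ee'] := uun _ _ ue.
have mmn : is_mono (m \oc n) by apply: mono_comp.
have [Z [h /is_kernelP[hmn _ uh]]] := ab_mono abC mmn.
have [|h' eh'] := uc _ h.
  by rewrite -ef -ee' (mcompA m) mcompA hmn mcomp0m.
have [|s es] := uh _ m; first by rewrite -eh' -mcompA cm mcompm0.
have ns : n \oc s = idm I by apply: mm; rewrite mcompA es mcompm1.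
by rewrite -(mcompm1 u) -ns mcompA un mcomp0m.
Qed.

Lemma factor_ex X Y (f : mor X Y) : exists I (m : mor I Y) (e : mor X I),
  [/\ is_mono m, is_epi e & m \oc e = f].
Proof.
have [K [c cc]] := ab_cokernel abC f; have [I [m km]] := ab_kernel abC c.
have [|e [ee <-]] := @image_factor _ _ f I m; first by exists K, c.
by exists I, m, e; split=> //; apply: kernel_mono km.
Qed.

Lemma factor_image X Y (f : mor X Y) I (m : mor I Y) (e : mor X I) :
  is_mono m -> is_epi e -> m \oc e = f -> is_image f m.
Proof.
move=> mm ee <-; have [K [c cc]] := ab_cokernel abC m.
exists K, c; split; first exact/epi_cokernel_comp.
exact: mono_kernel_coker.
Qed.

Lemma cokernel_refine X Y (f : mor X Y) K (c : mor Y K) T (t : mor T Y) :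
  is_cokernel f c -> c \oc t = 0 ->
  exists T' (e : mor T' T) (s : mor T' X), is_epi e /\ f \oc s = t \oc e.
Proof.
move=> cc ct; have [I [m [e [mm ee fE]]]] := factor_ex f.
have cm : is_cokernel m c by apply/(epi_cokernel_comp _ _ ee); rewrite fE.
have /is_kernelP[_ _ um] := mono_kernel_coker abC mm cm.
have [s es] := um _ _ ct; have [T' [e' [s' [ee' es']]]] := epi_refine s ee.
by exists T', e', s'; split=> //; rewrite -fE -mcompA es' mcompA es.
Qed.

(** [exact] only provides some image of [f]; this passes to an arbitrary epi-mono factorization. *)
Lemma exact_factor_kernel X Y Z (f : mor X Y) (g : mor Y Z) I (m : mor I Y)
    (e : mor X I) :
  exact f g -> is_mono m -> is_epi e -> m \oc e = f -> is_kernel g m.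
Proof.
move=> [J [m' [im /is_kernelP[gm' mm' um']]]] mm ee fE.
have [e' [ee' fE']] := image_factor im.
apply/is_kernelP; split=> //.
  by apply: ee; rewrite -mcompA fE -fE' mcompA gm' !mcomp0m.
move=> T t /um'[s <-]; have [T' [e2 [s2 [ee2 es2]]]] := epi_refine s ee'.
apply: (mono_descend mm ee2 (s := e \oc s2)).
by rewrite mcompA fE -fE' -!mcompA es2.
Qed.

Lemma factor_exact X Y Z (f : mor X Y) (g : mor Y Z) I (m : mor I Y)
    (e : mor X I) :
  is_kernel g m -> is_epi e -> m \oc e = f -> exact f g.
Proof.
move=> km ee fE; exists I, m; split=> //.
by apply: (factor_image _ ee fE); apply: kernel_mono km.
Qed.

Lemma epi_short_exact X Y Z (i : mor X Y) (p : mor Y Z) :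
  is_epi p -> is_kernel p i -> short_exact i p.
Proof. by move=> ep kp; split=> //; apply: epi_coker_kernel. Qed.

Lemma mono_short_exact X Y Z (i : mor X Y) (p : mor Y Z) :
  is_mono i -> is_cokernel i p -> short_exact i p.
Proof. by move=> mi cp; split=> //; apply: mono_kernel_coker. Qed.

Lemma kernel_compl X Y Z T (m : mor Z T) (p : mor Y Z) (i : mor X Y) :
  is_mono m -> is_kernel (m \oc p) i <-> is_kernel p i.
Proof.
move=> mm; split=> /is_kernelP[pi mi ui]; apply/is_kernelP; split=> //.
- by apply: mm; rewrite mcompA pi mcompm0.
- by move=> W t tf; apply: ui; rewrite -mcompA tf mcompm0.
- by rewrite -mcompA pi mcompm0.
- by move=> W t; rewrite -mcompA => tf; apply/ui/mm; rewrite tf mcompm0.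
Qed.

(* The pullback of [u, v] along [pi] splits, so [X] is the quotient of
   [Q (+) U] by [G']. *)
Lemma cover_cokernel G' Q G (k : mor G' Q) (pi : mor Q G) U X (u : mor U X)
    (v : mor X G) :
  is_projective Q -> short_exact k pi -> short_exact u v ->
  exists (l : mor Q X) (t : mor G' U) (S : C) (i1 : mor Q S) (i2 : mor U S)
    (p1 : mor S Q) (p2 : mor S U),
  is_biproduct i1 i2 p1 p2 /\
  is_cokernel (i1 \oc k - i2 \oc t) (l \oc p1 + u \oc p2).
Proof.
move=> pQ [/is_kernelP[pik mk uk] /cokernel_epi epi_pi].
move=> [/is_kernelP[vu mu uu] /cokernel_epi ev].
have [l el] := pQ _ _ v ev pi.
have [|t et] := uu _ (l \oc k); first by rewrite mcompA el.
have [S [i1 [i2 [p1 [p2 bS]]]]] := ab_biproduct abC Q U.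
exists l, t, S, i1, i2, p1, p2; split=> //; case: bS => e11 e22 e21 e12 eS.
set q := l \oc p1 + u \oc p2.
have qi1 : q \oc i1 = l by rewrite mcompDl -!mcompA e11 e21 mcompm0 mcompm1 addr0.
have qi2 : q \oc i2 = u by rewrite mcompDl -!mcompA e22 e12 mcompm0 mcompm1 add0r.
apply: (epi_coker_kernel abC).
  apply/epiP => T w wq.
  have wl : w \oc l = 0 by rewrite -qi1 mcompA wq mcomp0m.
  have wu : w \oc u = 0 by rewrite -qi2 mcompA wq mcomp0m.
  have /is_cokernelP[_ _ uv] : is_cokernel u v.
    by apply: epi_coker_kernel => //; apply/is_kernelP.
  have [w' ew'] := uv _ _ wu; rewrite -ew'.
  suff -> : w' = 0 by rewrite mcomp0m.
  by apply: epi_pi; rewrite mcomp0m -el mcompA ew'.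
apply/is_kernelP; split.
- by rewrite mcompBr !mcompA qi1 qi2 et subrr.
- apply: (@mono_compr _ _ _ p1).
  by rewrite mcompBr !mcompA e11 e12 mcomp1m mcomp0m subr0.
move=> T s qs.
have vq : v \oc q = pi \oc p1.
  by rewrite mcompDr !mcompA el vu mcomp0m addr0.
have [|g eg] := uk _ (p1 \oc s); first by rewrite mcompA -vq -mcompA qs mcompm0.
have eu : u \oc (t \oc g + p2 \oc s) = 0.
  by rewrite mcompDr !mcompA et -!mcompA eg !mcompA -mcompDl.
have e0 : t \oc g + p2 \oc s = 0 by apply: mu; rewrite eu mcompm0.
exists g; rewrite mcompBl -[RHS]mcomp1m -eS mcompDl -!mcompA eg -mcompmN.
by congr (_ + _ \oc _); apply/eqP; rewrite eq_sym -addr_eq0 addrC; apply/eqP.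
Qed.

(** One projective presentation decides. With [X] written as a quotient of [Q (+) U], extend
    [f \oc t] along [k] to [h]; the map [(h, f)] kills the relation [(k, - t)] and descends to
    [X]. *)
Lemma ext_vanish_cover G' Q G (k : mor G' Q) (pi : mor Q G) T :
  is_projective Q -> short_exact k pi ->
  (forall f : mor G' T, exists g : mor Q T, g \oc k = f) -> ext_vanish G T.
Proof.
move=> pQ sk ext U X u v suv f.
have [l [t [S [i1 [i2 [p1 [p2 [[e11 e22 e21 e12 _]]]]]]]]] :=
  cover_cokernel pQ sk suv.
move=> /is_cokernelP[_ _ uc]; have [h hk] := ext (f \oc t).
have [|g eg] := uc _ (h \oc p1 + f \oc p2).
  rewrite mcompDl !mcompBr -!mcompA !(compA e11) !(compA e22) !(compA e21).
  by rewrite !(compA e12) !mcomp0m !mcomp1m hk !mcompm0 subr0 sub0r subrr.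
exists g; have := congr1 (fun x => x \oc i2) eg.
by rewrite /= mcompDl mcompDr mcompDl -!mcompA e12 e22 !mcompm0 !add0r !mcompm1.
Qed.

Lemma ext_vanish_biprod G T1 T2 T (i1 : mor T1 T) (i2 : mor T2 T)
    (p1 : mor T T1) (p2 : mor T T2) :
  is_biproduct i1 i2 p1 p2 -> ext_vanish G T1 -> ext_vanish G T2 ->
  ext_vanish G T.
Proof.
move=> [_ _ _ _ eT] x1 x2 U X u v suv f.
have [g1 e1] := x1 _ _ _ _ suv (p1 \oc f); have [g2 e2] := x2 _ _ _ _ suv (p2 \oc f).
exists (i1 \oc g1 + i2 \oc g2).
by rewrite mcompDl -!mcompA e1 e2 !mcompA -mcompDl eT mcomp1m.
Qed.

End Abelian.

(** * Dependent choice in both directions *)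

Section IntegerChoice.
Variables (S : Type) (R : S -> S -> Prop).
Hypotheses (up : forall s, exists t, R s t) (down : forall s, exists t, R t s).

Lemma int_dependent_choice (s0 : S) :
  exists f : int -> S, f 0 = s0 /\ forall n, R (f n) (f (n + 1)).
Proof.
pose u s := constructive_indefinite_description _ (up s).
pose d s := constructive_indefinite_description _ (down s).
exists (fun n => match n with
  | Posz k => iter k (fun s => sval (u s)) s0
  (* [Negz k] is [-(k + 1)], hence [k.+1] downward steps. *)
  | Negz k => iter k.+1 (fun s => sval (d s)) s0 end).
split=> // -[k|[|k]].
- by rewrite -PoszD addn1; apply: svalP (u _).
- exact: svalP (d _).
- have -> : Negz k.+1 + 1 = Negz k by rewrite !NegzE -[in LHS]addn1 PoszD opprD addrNK.
  exact: svalP (d _).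
Qed.

End IntegerChoice.

(** * Syzygies, splicing and Gorenstein projective objects *)

Section Gorenstein.
Variables (C : preadditive_category) (abC : is_abelian C).
Implicit Types X Y Z T G : C.

(** An epi-mono factorization rather than a chosen image makes the notion invariant under
    isomorphism; any index is allowed, not only [-1]. *)
Definition syzygy (Q : sequence C) (n : int) G :=
  exists (e : mor (Q n) G) (m : mor G (Q (n + 1))),
    [/\ is_epi e, is_mono m & m \oc e = seq_diff Q n].

Lemma syzygy_ex Q n : exists G, syzygy Q n G.
Proof. by have [I [m [e [mm ee eq]]]] := factor_ex abC (seq_diff Q n); exists I, e, m. Qed.

Lemma syzygy_short_exact (Q : sequence C) n G G' (e : mor (Q n) G)
    (m : mor G (Q (n + 1))) (e' : mor (Q (n + 1)) G')
    (m' : mor G' (Q (n + 1 + 1))) :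
  exact_sequence Q -> is_epi e -> is_mono m -> m \oc e = seq_diff Q n ->
  is_epi e' -> is_mono m' -> m' \oc e' = seq_diff Q (n + 1) ->
  short_exact m e'.
Proof.
move=> xQ ee mm eq ee' mm' eq'; apply: epi_short_exact => //.
apply/(kernel_compl _ _ mm'); rewrite eq'.
exact: exact_factor_kernel (xQ n) mm ee eq.
Qed.

(** With [G'] the preceding syzygy, [f \oc e1] kills the incoming differential, so hom-exactness
    extends it along the next one, and thereby [f] along [m1]. *)
Lemma syzygy_ext_vanish Q n G T :
  complete_resolution Q -> hom_exact Q T -> syzygy Q n G -> ext_vanish G T.
Proof.
move=> [pQ xQ _] hQ; rewrite -(subrK 1 n) -(subrK 1 (n - 1)).
set m := n - 1 - 1; move=> [e [mm [ee mmm eq]]].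
have [G' [e1 [m1 [ee1 mm1 eq1]]]] := syzygy_ex Q (m + 1).
have s1 := syzygy_short_exact xQ ee1 mm1 eq1 ee mmm eq.
apply: (ext_vanish_cover abC _ s1) => // f.
have d0 : seq_diff Q (m + 1) \oc seq_diff Q m = 0.
  have [G0 [e2 [m2 [ee2 mm2 eq2]]]] := syzygy_ex Q m.
  have [/is_kernelP[k0 _ _] _] := syzygy_short_exact xQ ee2 mm2 eq2 ee1 mm1 eq1.
  by rewrite -eq1 -eq2 -mcompA (compA k0) mcomp0m mcompm0.
have [|h eh] := (hQ m (f \oc e1)).1.
  rewrite -mcompA (_ : e1 \oc _ = 0) ?mcompm0 //.
  by apply: mm1; rewrite mcompA eq1 d0 mcompm0.
by exists h; apply: ee1; rewrite -mcompA eq1.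
Qed.

Section Splice.
Variable W : C -> Prop.
Hypothesis W_up : forall G, W G -> exists Q G' (i : mor G Q) (p : mor Q G'),
  [/\ is_projective Q, W G' & short_exact i p].
Hypothesis W_down : forall G, W G -> exists Q G' (i : mor G' Q) (p : mor Q G),
  [/\ is_projective Q, W G' & short_exact i p].

(** Dependent choice on objects of [W], related when a short exact sequence with projective middle
    joins them; the sequences themselves are chosen afterwards. *)
Lemma splice G : W G -> exists (g Q : int -> C) (i : forall n, mor (g n) (Q n))
    (p : forall n, mor (Q n) (g (n + 1))),
  [/\ g 0 = G, forall n, W (g n), forall n, is_projective (Q n)
    & forall n, short_exact (i n) (p n)].
Proof.
move=> wG; pose S := {G | W G}.
pose R (s t : S) := exists x : {Q : C & (mor (sval s) Q * mor Q (sval t))%type},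
  is_projective (tag x) /\ short_exact (tagged x).1 (tagged x).2.
have [s|s|f [f0 fR]] := @int_dependent_choice S R _ _ (exist _ G wG).
- have [Q [G' [i [p [pQ wG' sip]]]]] := W_up (svalP s).
  by exists (exist _ G' wG'), (existT _ Q (i, p)).
- have [Q [G' [i [p [pQ wG' sip]]]]] := W_down (svalP s).
  by exists (exist _ G' wG'), (existT _ Q (i, p)).
pose x n := sval (constructive_indefinite_description _ (fR n)).
have xP n : is_projective (tag (x n)) /\
    short_exact (tagged (x n)).1 (tagged (x n)).2.
  exact: svalP (constructive_indefinite_description _ (fR n)).
exists (fun n => sval (f n)), (fun n => tag (x n)), (fun n => (tagged (x n)).1),
  (fun n => (tagged (x n)).2); split=> [|n|n|n].
- by rewrite f0.
- exact: svalP.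
- by case: (xP n).
- by case: (xP n).
Qed.

Definition spliced (g Q : int -> C) (i : forall n, mor (g n) (Q n))
    (p : forall n, mor (Q n) (g (n + 1))) :=
  Sequence (fun n => i (n + 1) \oc p n).

Lemma spliced_exact (g Q : int -> C) (i : forall n, mor (g n) (Q n))
    (p : forall n, mor (Q n) (g (n + 1))) :
  (forall n, short_exact (i n) (p n)) -> exact_sequence (spliced i p).
Proof.
move=> s n; apply: (@factor_exact _ abC _ _ _ _ _ _ (i (n + 1)) (p n)) => //.
  apply/kernel_compl; last by case: (s (n + 1)).
  by case: (s (n + 1 + 1)) => /kernel_mono.
by case: (s n) => _ /cokernel_epi.
Qed.

Hypothesis W_ext : forall G P, W G -> is_projective P -> ext_vanish G P.

Lemma gorenstein_projective_splice G : W G -> gorenstein_projective G.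
Proof.
move=> wG; have [g [Q [i [p [g0 wg pQ s]]]]] := splice wG.
exists (spliced i p); split.
  split=> //; first exact: spliced_exact.
  move=> P pP n f; split=> [fd|[h <-]]; last first.
    rewrite -mcompA /= -mcompA (compA (_ : p (n + 1) \oc i (n + 1) = 0)).
      by rewrite mcomp0m !mcompm0.
    by case: (s (n + 1)) => [[]].
  (* [f] kills [i (n + 1)], so it factors through [p (n + 1)]; the factor extends along
     [i (n + 1 + 1)] by vanishing of [Ext^1]. *)
  have /is_cokernelP[_ _ uc] := (s (n + 1)).2.
  have [|f' ef'] := uc _ f.
    by apply: (cokernel_epi (s n).2); rewrite -mcompA fd mcomp0m.
  have [h eh] := W_ext (wg _) pP (s (n + 1 + 1)) f'.
  by exists h; rewrite /= mcompA eh.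
(* [-1 + 1] computes to [0], so [i 0] is the mono part of the differential at [-1]. *)
exists (g 0), (i 0); split; last by rewrite g0; exists (idm G), (idm G); rewrite mcomp1m.
apply: (factor_image abC (e := p (-1))) => //.
  exact: kernel_mono (s 0).1.
exact: cokernel_epi (s (-1)).2.
Qed.

End Splice.

Lemma gorenstein_syzygy G : gorenstein_projective G ->
  exists Q n, complete_resolution Q /\ syzygy Q n G.
Proof.
move=> [Q [cQ [I [m [im [a [b [ba ab]]]]]]]]; exists Q, (-1); split=> //.
have [e [ee eq]] := image_factor abC im.
have [K [c [_ km]]] := im; have mm := kernel_mono km.
exists (b \oc e), (m \oc a); split.
- by apply: epi_comp => //; apply: split_epi ba.
- by apply: mono_comp => //; apply: split_mono ba.
- by rewrite -mcompA (compA ab) mcomp1m.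
Qed.

Lemma syzygy_up Q n G : complete_resolution Q -> syzygy Q n G ->
  exists G' (i : mor G (Q (n + 1))) (p : mor (Q (n + 1)) G'),
    syzygy Q (n + 1) G' /\ short_exact i p.
Proof.
move=> [_ xQ _] [e [m [ee mm eq]]].
have [G' [e' [m' [ee' mm' eq']]]] := syzygy_ex Q (n + 1).
exists G', m, e'; split; first by exists e', m'.
exact: syzygy_short_exact xQ ee mm eq ee' mm' eq'.
Qed.

Lemma syzygy_down Q n G : complete_resolution Q -> syzygy Q (n + 1) G ->
  exists G' (i : mor G' (Q (n + 1))) (p : mor (Q (n + 1)) G),
    syzygy Q n G' /\ short_exact i p.
Proof.
move=> [_ xQ _] [e [m [ee mm eq]]].
have [G' [e' [m' [ee' mm' eq']]]] := syzygy_ex Q n.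
exists G', m', e; split; first by exists e', m'.
exact: syzygy_short_exact xQ ee' mm' eq' ee mm eq.
Qed.

(** Instead of shifting [Q] to bring [n] to [-1], the splicing criterion is applied to the class of
    all syzygies of complete resolutions. *)
Lemma syzygy_gorenstein Q n G :
  complete_resolution Q -> syzygy Q n G -> gorenstein_projective G.
Proof.
move=> cQ sG.
pose W G := exists Q n, complete_resolution Q /\ syzygy Q n G.
apply: (@gorenstein_projective_splice W); last by exists Q, n.
- move=> {cQ sG}G [{}Q [{}n [cQ sG]]]; have [G' [i [p [sG' s]]]] := syzygy_up cQ sG.
  exists (Q (n + 1)), G', i, p; split=> //; first by case: cQ.
  by exists Q, (n + 1).
- move=> {cQ sG}G [{}Q [{}n [cQ]]]; rewrite -(subrK 1 n) => sG.
  have [G' [i [p [sG' s]]]] := syzygy_down cQ sG.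
  exists (Q (n - 1 + 1)), G', i, p; split=> //; first by case: cQ.
  by exists Q, (n - 1).
- move=> {cQ sG}G P [{}Q [{}n [cQ sG]]] pP; apply: syzygy_ext_vanish sG => //.
  by case: cQ => _ _; apply.
Qed.

Lemma gorenstein_up G : gorenstein_projective G ->
  exists Q G' (i : mor G Q) (p : mor Q G'),
    [/\ is_projective Q, gorenstein_projective G' & short_exact i p].
Proof.
move=> /gorenstein_syzygy[Q [n [cQ sG]]].
have [G' [i [p [sG' s]]]] := syzygy_up cQ sG.
exists (Q (n + 1)), G', i, p; split=> //; first by case: cQ.
exact: syzygy_gorenstein sG'.
Qed.

Lemma gorenstein_down G : gorenstein_projective G ->
  exists Q G' (i : mor G' Q) (p : mor Q G),
    [/\ is_projective Q, gorenstein_projective G' & short_exact i p].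
Proof.
move=> /gorenstein_syzygy[Q [n [cQ]]]; rewrite -(subrK 1 n) => sG.
have [G' [i [p [sG' s]]]] := syzygy_down cQ sG.
exists (Q (n - 1 + 1)), G', i, p; split=> //; first by case: cQ.
exact: syzygy_gorenstein sG'.
Qed.

(** Only hom-exactness into [T] is asked, so that (P2) can supply it for [T = FQ], which need not be
    projective. *)
Lemma gorenstein_ext_vanish G T : gorenstein_projective G ->
  (forall Q, complete_resolution Q -> hom_exact Q T) -> ext_vanish G T.
Proof.
move=> /gorenstein_syzygy[Q [n [cQ sG]]] hT.
exact: syzygy_ext_vanish (hT _ cQ) sG.
Qed.

Lemma gorenstein_ext_projective G P :
  gorenstein_projective G -> is_projective P -> ext_vanish G P.
Proof. by move=> gG pP; apply: gorenstein_ext_vanish => // Q [_ _]; apply. Qed.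

Lemma gorenstein_isomorphic G G' :
  isomorphic G' G -> gorenstein_projective G -> gorenstein_projective G'.
Proof.
move=> [f [g [gf fg]]] [Q [cQ [I [m [im [a [b [ba ab]]]]]]]].
exists Q; split=> //; exists I, m; split=> //; exists (a \oc f), (g \oc b).
by rewrite -mcompA (compA ba) mcomp1m gf -mcompA (compA fg) mcomp1m ab.
Qed.

End Gorenstein.

(** An element killed by [m] lifts, after refinement, to [Y]; by exactness the lift lies in the
    image of [f], which [c] kills. *)
Lemma exact_coimage_mono (C : preadditive_category) (abC : is_abelian C)
    (X Y Z K : C) (f : mor X Y) (c : mor Y K) (m : mor K Z) :
  exact f (m \oc c) -> is_cokernel f c -> is_mono m.
Proof.
move=> [I [i [im /is_kernelP[_ _ ui]]]] cc; have [e [ee ie]] := image_factor abC im.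
apply/monoP => T x mx; have ec := cokernel_epi cc.
have [T' [e' [s [ee' es]]]] := epi_refine abC x ec.
have [|s' es'] := ui _ s; first by rewrite -mcompA es mcompA mx mcomp0m.
apply: ee'; apply/eqP; rewrite mcomp0m -es -es'; apply/eqP.
suff -> : c \oc (i \oc s') = 0 by [].
rewrite mcompA (_ : c \oc i = 0) ?mcomp0m //; apply: ee.
by rewrite mcomp0m -mcompA ie; case: cc.
Qed.

Lemma split_biproduct (C : preadditive_category) (X Y K : C) (m : mor X Y)
    (r : mor Y X) (c : mor Y K) :
  r \oc m = idm X -> is_cokernel m c ->
  exists s : mor K Y, is_biproduct m s r c.
Proof.
move=> rm /is_cokernelP[cm ec uc]; have [|s es] := uc _ (idm Y - m \oc r).
  by rewrite mcompBl -mcompA rm mcomp1m mcompm1 subrr.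
exists s; split=> //.
- by apply: ec; rewrite -mcompA es mcompBr (compA cm) mcomp0m mcompm1 mcomp1m subr0.
- by apply: ec; rewrite -mcompA es mcompBr (compA rm) mcomp1m mcompm1 mcomp0m subrr.
- by rewrite es addrCA subrr addr0.
Qed.

Lemma biproduct_cokernel (C : preadditive_category) (X Y S : C)
    (i1 : mor X S) (i2 : mor Y S) (p1 : mor S X) (p2 : mor S Y) :
  is_biproduct i1 i2 p1 p2 -> is_cokernel i1 p2.
Proof.
move=> [_ e22 e21 _ eS]; apply/is_cokernelP; split=> //.
  exact: split_epi e22.
move=> T t t0; exists (t \oc i2).
by rewrite -[RHS]mcompm1 -eS mcompDr !mcompA t0 mcomp0m add0r.
Qed.

(** * Exactness of a perfect functor *)

Section Perfect.
Variables (A B : preadditive_category) (abA : is_abelian A) (abB : is_abelian B).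
Variables (F : additive_functor A B) (rF : right_exact F) (pF : perfect F).

(* The first left derived functor of [F] vanishes on [Y]. *)
Lemma perfect_mono (W : A -> Prop) :
  (forall G, W G -> exists Q G' (i : mor G Q) (p : mor Q G'),
    [/\ is_projective Q, W G' & short_exact i p]) ->
  (forall G, W G -> exists Q G' (i : mor G' Q) (p : mor Q G),
    [/\ is_projective Q, W G' & short_exact i p]) ->
  forall (Y U V : A) (u : mor U V) (v : mor V Y),
  W Y -> short_exact u v -> is_mono (fmap F u).
Proof.
move=> Wup Wdown Y U V u v wY suv.
have [g [Q [i [p [g0 _ pQ s]]]]] := splice Wup Wdown wY; subst Y.
have Fp n : is_cokernel (fmap F (i n)) (fmap F (p n)).
  exact: right_exact_cokernel (s n).2.
(* By (P1) the image of the spliced sequence is exact, and this map is induced by one of its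
   differentials on the cokernel of the previous one. *)
have Fi n : is_mono (fmap F (i (n + 1 + 1))).
  have := pF.1 (spliced i p) pQ (spliced_exact abA s) n.
  rewrite /= 2!fmap_comp => /exact_coimage_mono; apply=> //.
  by apply/epi_cokernel_comp => //; apply: cokernel_epi (Fp n).
have [l [t [S [i1 [i2 [p1 [p2 [[e11 e22 e21 e12 _] cq]]]]]]]] :=
  cover_cokernel abA (pQ (-1)) (s (-1)) suv.
set q := l \oc p1 + u \oc p2 in cq.
have qi2 : q \oc i2 = u.
  by rewrite mcompDl -!mcompA e22 e12 mcompm0 mcompm1 add0r.
(* If [F u] kills [x], then after refinement [F i2 \oc x] comes from some [y] in [F (g (-1))]; its
   [Q]-component shows [F (i (-1)) \oc y = 0], so [y = 0]. *)
apply/monoP => T x ux.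
have [|T' [e [y [ee ey]]]] :=
    cokernel_refine abB (t := fmap F i2 \oc x) (right_exact_cokernel abA abB rF cq).
  by rewrite mcompA -fmap_comp qi2.
have y0 : y = 0.
  (* [-3 + 1 + 1] is the index [-1] of the presentation of [Y]. *)
  apply: (Fi (-1 - 1 - 1)); rewrite mcompm0.
  have := congr1 (fun z => fmap F p1 \oc z) ey.
  rewrite /= !mcompA -!fmap_comp mcompBr !mcompA e11 e12 mcomp1m mcomp0m subr0.
  by rewrite fmap0 !mcomp0m.
apply: ee; rewrite mcomp0m.
have := congr1 (fun z => fmap F p2 \oc z) ey.
by rewrite y0 /= !mcompm0 !mcompA -!fmap_comp e22 fmap1 mcomp1m.
Qed.

(** * Short exact sequences in the comma category *)

Local Notation C := (comma F).
Let abC : is_abelian C := comma_is_abelian abA abB rF.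

(** Left to right, the given kernel and cokernel are isomorphic to the componentwise ones, and the
    isomorphisms are transported to each component. *)
Lemma comma_short_exact (M N P : C) (f : mor M N) (g : mor N P) :
  short_exact f g <-> short_exact (comma_top f) (comma_top g) /\
                      short_exact (comma_bot f) (comma_bot g).
Proof.
split=> [[kf cg]|[[kt ct] [kb cb]]]; last first.
  by split; [apply: comma_kernel | apply: comma_cokernel].
have [K [k [kA kB]]] := comma_kernel_ex abA abB g.
have [D [d [dA dB]]] := comma_cokernel_ex abA abB rF f.
have [a [b [ba ab _ kb]]] := kernel_iso (comma_kernel kA kB) kf.
have [a' [b' [ba' ab' dk' _]]] :=
  cokernel_iso (comma_cokernel abA abB rF dA dB) cg.
have top x y (h : @mor C x y) h' : h = h' -> comma_top h = comma_top h' by move->.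
have bot x y (h : @mor C x y) h' : h = h' -> comma_bot h = comma_bot h' by move->.
split; split.
- exact: kernel_transport (top _ _ _ _ ba) (top _ _ _ _ ab) (top _ _ _ _ kb) kA.
- exact: cokernel_transport (top _ _ _ _ ba') (top _ _ _ _ ab') (top _ _ _ _ dk') dA.
- exact: kernel_transport (bot _ _ _ _ ba) (bot _ _ _ _ ab) (bot _ _ _ _ kb) kB.
- exact: cokernel_transport (bot _ _ _ _ ba') (bot _ _ _ _ ab') (bot _ _ _ _ dk') dB.
Qed.

Lemma coker_map (M N : C) (f : mor M N) (KM KN : B) (cM : mor (cbot M) KM)
    (cN : mor (cbot N) KN) :
  is_cokernel (cmap M) cM -> is_cokernel (cmap N) cN ->
  exists k : mor KM KN, k \oc cM = cN \oc comma_bot f.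
Proof.
move=> /is_cokernelP[_ _ uM] [cN0 _].
by apply: uM; rewrite -mcompA comma_homE (compA cN0) mcomp0m.
Qed.

(** * Snake lemma for the structure maps *)

Section CokerSequence.
Variables (M N P : C) (f : mor M N) (g : mor N P).
Hypothesis sfg : short_exact f g.
Variables (KM KN KP : B) (cM : mor (cbot M) KM) (cN : mor (cbot N) KN)
  (cP : mor (cbot P) KP).
Hypotheses (ccM : is_cokernel (cmap M) cM) (ccN : is_cokernel (cmap N) cN)
  (ccP : is_cokernel (cmap P) cP).
Variables (k1 : mor KM KN) (k2 : mor KN KP).
Hypotheses (ek1 : k1 \oc cM = cN \oc comma_bot f)
  (ek2 : k2 \oc cN = cP \oc comma_bot g).

Let Fg : is_cokernel (fmap F (comma_top f)) (fmap F (comma_top g)).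
Proof.
have [[_ ct] _] := (comma_short_exact _ _).1 sfg.
exact: right_exact_cokernel ct.
Qed.

(** Lift [w] to [v] in [F (ctop N)]; its image in [cbot N] comes from [x] in [cbot M]. As [k1] is
    mono, [x] lies in the image of [cmap M], so [v] comes from [F (ctop M)] and [w] vanishes. *)
Lemma comma_quotient_mono : is_mono (cmap N) -> is_mono k1 -> is_mono (cmap P).
Proof.
move=> mN mk1; apply/monoP => T w w0.
have [_ [/is_kernelP[gf mf uf] _]] := (comma_short_exact _ _).1 sfg.
have [T1 [e1 [v [ee1 ev]]]] := epi_refine abB w (cokernel_epi Fg).
have [|x ex] := uf _ (cmap N \oc v).
  by rewrite mcompA comma_homE -mcompA ev mcompA w0 mcomp0m.
have cx : cM \oc x = 0.
  by apply: mk1; rewrite mcompm0 mcompA ek1 -mcompA ex mcompA ccN.1 mcomp0m.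
have [T2 [e2 [u [ee2 eu]]]] := cokernel_refine abB ccM cx.
have vE : v \oc e2 = fmap F (comma_top f) \oc u.
  by apply: mN; rewrite !mcompA -ex -comma_homE -!mcompA eu.
apply: ee1; apply: ee2; rewrite !mcomp0m -ev -mcompA vE mcompA Fg.1.
by rewrite mcomp0m.
Qed.

Hypotheses (mN : is_mono (cmap N)) (mP : is_mono (cmap P)).

(** In the snake sequence the kernel of [cmap P], here zero, maps onto the kernel of [k1]. *)
Let mk1 : is_mono k1.
Proof.
have [_ [/is_kernelP[gf mf uf] _]] := (comma_short_exact _ _).1 sfg.
have /is_kernelP[_ _ uN] := mono_kernel_coker abB mN ccN.
apply/monoP => T t t0; have [T1 [e1 [x [ee1 ex]]]] := epi_refine abB t (cokernel_epi ccM).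
have [|v ev] := uN _ (comma_bot f \oc x).
  by rewrite mcompA -ek1 -mcompA ex mcompA t0 mcomp0m.
have [|T2 [e2 [u [ee2 eu]]]] := cokernel_refine abB (t := v) Fg.
  apply: mP; rewrite mcompm0 mcompA -comma_homE -mcompA ev mcompA gf.
  by rewrite mcomp0m.
have xE : x \oc e2 = cmap M \oc u.
  by apply: mf; rewrite !mcompA comma_homE -(mcompA (cmap N)) eu mcompA ev.
by apply: ee1; apply: ee2; rewrite !mcomp0m -ex -mcompA xE mcompA ccM.1 mcomp0m.
Qed.

(** For exactness in the middle, a lift [z] of [t] is corrected by an element [v] of [F (ctop N)]
    until it comes from [cbot M]; the preimage so found descends since [k1] is mono. *)
Lemma coker_short_exact : short_exact k1 k2.
Proof.
have [_ [/is_kernelP[gf mf uf] cg]] := (comma_short_exact _ _).1 sfg.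
have ek2e : is_epi k2.
  apply: (@epi_compl _ _ _ _ _ cN); rewrite ek2; apply: epi_comp.
    exact: cokernel_epi ccP.
  exact: cokernel_epi cg.
have /is_kernelP[_ _ uP] := mono_kernel_coker abB mP ccP.
apply: epi_short_exact => //; apply/is_kernelP; split=> //.
  apply: (cokernel_epi ccM).
  by rewrite mcomp0m -mcompA ek1 mcompA ek2 -mcompA gf mcompm0.
move=> T t t0; have [T1 [e1 [z [ee1 ez]]]] := epi_refine abB t (cokernel_epi ccN).
have [|w ew] := uP _ (comma_bot g \oc z).
  by rewrite mcompA -ek2 -mcompA ez mcompA t0 mcomp0m.
have [T2 [e2 [v [ee2 ev]]]] := epi_refine abB w (cokernel_epi Fg).
have [|x ex] := uf _ (z \oc e2 - cmap N \oc v).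
  rewrite mcompBr mcompA -ew -mcompA -ev mcompA -comma_homE.
  by rewrite mcompA subrr.
apply: (mono_descend abB mk1 (epi_comp ee1 ee2) (s := cM \oc x)).
rewrite mcompA ek1 -mcompA ex mcompBr (compA ccN.1) mcomp0m subr0.
by rewrite !mcompA ez.
Qed.

End CokerSequence.

(** * Projective objects of the comma category *)

Lemma comma_projective (M : C) P (i2 : mor P (cbot M)) (p1 : mor (cbot M) _)
    (p2 : mor (cbot M) P) :
  is_projective (ctop M) -> is_projective P ->
  is_biproduct (cmap M) i2 p1 p2 -> is_projective M.
Proof.
move=> pT pP [e11 e22 e21 e12 eM] U V e /(comma_epi_sub abA abB rF)[eT eB] f.
have [a ea] := pT _ _ _ eT (comma_top f).
have [b eb] := pP _ _ _ eB (comma_bot f \oc i2).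
pose h := cmap U \oc fmap F a \oc p1 + b \oc p2.
have sq : h \oc cmap M = cmap U \oc fmap F a.
  by rewrite mcompDl -!mcompA e11 e21 mcompm0 addr0 mcompm1.
exists (comma_homI sq); apply: comma_hom_eq => //=.
rewrite -/(comma_bot e) -/(comma_bot f) mcompDr !mcompA comma_homE eb.
rewrite -(mcompA (cmap V)) -fmap_comp ea -comma_homE -!mcompA -mcompDr.
by rewrite eM mcompm1.
Qed.

Lemma comma_projective_free Q : is_projective Q ->
  is_projective (Comma (idm (F Q)) : C).
Proof.
move=> pQ; have [Z zZ] := ab_zero abB.
have zm X (f : mor Z X) : f = 0 by case: (zZ X).
apply: (@comma_projective (Comma (idm (F Q))) Z 0 (idm _) 0) => //=.
  by move=> X Y e _ f; exists 0; rewrite mcompm0 (zm _ f).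
split; rewrite ?mcomp1m ?mcompm0 ?mcomp0m ?addr0 //.
Qed.

Lemma comma_projective_bot P Z : is_zero Z -> is_projective P ->
  is_projective (Comma (0 : mor (F Z) P) : C).
Proof.
move=> zZ pP; have zm X (f : mor Z X) : f = 0 by case: (zZ X).
apply: (@comma_projective (Comma (0 : mor (F Z) P)) P (idm _) 0 (idm _)) => //=.
  by move=> X Y e _ f; exists 0; rewrite mcompm0 (zm _ f).
split; rewrite ?mcomp1m ?mcompm0 ?mcomp0m ?add0r //.
by rewrite -fmap1 (zm _ (idm Z)) fmap0.
Qed.

(** [ctop] is left adjoint to [U |-> (U, 0)], which preserves epimorphisms. *)
Lemma comma_projective_top (M : C) : is_projective M -> is_projective (ctop M).
Proof.
move=> pM U V e ee f; have [Z zZ] := ab_zero abB.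
have zm X (h : mor Z X) : h = 0 by case: (zZ X).
have sqe : idm Z \oc (0 : mor (F U) Z) = (0 : mor (F V) Z) \oc fmap F e.
  by rewrite mcomp0m mcompm0.
have sqf : (0 : mor (cbot M) Z) \oc cmap M = (0 : mor (F V) Z) \oc fmap F f.
  by rewrite !mcomp0m.
have [|h eh] := pM _ _ (@comma_homI _ _ F (Comma (0 : mor (F U) Z))
    (Comma (0 : mor (F V) Z)) e (idm Z) sqe) _
    (@comma_homI _ _ F M (Comma (0 : mor (F V) Z)) f 0 sqf).
  move=> T g g' eg; apply: comma_hom_eq.
    exact: (ee _ _ _ (congr1 (@comma_top _ _ F _ _) eg)).
  exact: etrans (zm _ (comma_bot g)) (esym (zm _ (comma_bot g'))).
by exists (comma_top h); apply: (congr1 (@comma_top _ _ F _ _) eh).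
Qed.

(** The cokernel of the structure map is left adjoint to [U |-> (0, U)], which preserves
    epimorphisms. *)
Lemma comma_projective_coker (M : C) K (c : mor (cbot M) K) :
  is_projective M -> is_cokernel (cmap M) c -> is_projective K.
Proof.
move=> pM /is_cokernelP[c0 ec uc] U V e ee f; have [Z zZ] := ab_zero abA.
have zm X (h : mor X Z) : h = 0 by case: (zZ X).
have sqe : e \oc (0 : mor (F Z) U) = (0 : mor (F Z) V) \oc fmap F (idm Z).
  by rewrite mcomp0m mcompm0.
have sqf : (f \oc c) \oc cmap M = (0 : mor (F Z) V) \oc fmap F 0.
  by rewrite mcomp0m -mcompA c0 mcompm0.
have [|h eh] := pM _ _ (@comma_homI _ _ F (Comma (0 : mor (F Z) U))
    (Comma (0 : mor (F Z) V)) (idm Z) e sqe) _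
    (@comma_homI _ _ F M (Comma (0 : mor (F Z) V)) 0 (f \oc c) sqf).
  move=> T g g' eg; apply: comma_hom_eq; last first.
    exact: (ee _ _ _ (congr1 (@comma_bot _ _ F _ _) eg)).
  have := congr1 (@comma_top _ _ F _ _) eg.
  by rewrite /comma_top /= !mcompm1.
have [|k ek] := uc _ (comma_bot h); first by rewrite comma_homE mcomp0m.
exists k; apply: ec; rewrite -mcompA ek.
exact: (congr1 (@comma_bot _ _ F _ _) eh).
Qed.

(* Splitness comes from lifting the identity of [M] along the epimorphism
   [(1, (phi, 1))] from [(Y, FY (+) X)] to [M = (Y, X)]. *)
Lemma comma_projective_split (M : C) : is_projective M ->
  exists r, r \oc cmap M = idm (F (ctop M)).
Proof.
move=> pM; have [S [i1 [i2 [p1 [p2 [e11 e22 e21 e12 eS]]]]]] :=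
  ab_biproduct abB (F (ctop M)) (cbot M).
pose q := cmap M \oc p1 + p2.
have sq : q \oc i1 = cmap M \oc fmap F (idm _).
  by rewrite mcompDl -mcompA e11 e21 addr0 fmap1.
have qi2 : q \oc i2 = idm _ by rewrite mcompDl -mcompA e12 e22 mcompm0 add0r.
have [|h eh] := pM _ _ (@comma_homI _ _ F (Comma i1) M (idm _) q sq) _ (idm M).
  move=> T g g' eg; apply: comma_hom_eq.
    have := congr1 (@comma_top _ _ F _ _) eg.
    by rewrite /comma_top /= !mcompm1.
  exact: (split_epi qi2 (congr1 (@comma_bot _ _ F _ _) eg)).
have hT : comma_top h = idm _.
  by rewrite -[LHS]mcomp1m; apply: (congr1 (@comma_top _ _ F _ _) eh).
exists (p1 \oc comma_bot h).
by rewrite -mcompA (comma_homE h) hT mcompA /= e11 mcomp1m fmap1.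
Qed.

(** * From (1) to (2) *)

Let gp_ext_free (G : B) Q : gorenstein_projective G -> is_projective Q ->
  ext_vanish G (F Q).
Proof. by move=> gG pQ; apply: gorenstein_ext_vanish => // P cP; apply: pF.2. Qed.

(** Tops of Gorenstein projective comma objects are not yet known to be Gorenstein projective, so
    [perfect_mono] is applied to the class of these tops. *)
Let gpc_top_up (Y : A) :
  (exists2 M : C, gorenstein_projective M & ctop M = Y) ->
  exists Q Y' (i : mor Y Q) (p : mor Q Y'), [/\ is_projective Q,
    exists2 M : C, gorenstein_projective M & ctop M = Y' & short_exact i p].
Proof.
move=> [M gM <-]; have [Q [M' [i [p [pQ gM' /comma_short_exact[sT _]]]]]] :=
  gorenstein_up abC gM.
exists (ctop Q), (ctop M'), (comma_top i), (comma_top p); split=> //.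
  exact: comma_projective_top.
by exists M'.
Qed.

Let gpc_top_down (Y : A) :
  (exists2 M : C, gorenstein_projective M & ctop M = Y) ->
  exists Q Y' (i : mor Y' Q) (p : mor Q Y), [/\ is_projective Q,
    exists2 M : C, gorenstein_projective M & ctop M = Y' & short_exact i p].
Proof.
move=> [M gM <-]; have [Q [M' [i [p [pQ gM' /comma_short_exact[sT _]]]]]] :=
  gorenstein_down abC gM.
exists (ctop Q), (ctop M'), (comma_top i), (comma_top p); split=> //.
  exact: comma_projective_top.
by exists M'.
Qed.

(** For [M] embedded in a projective [Q], [comma_bot i \oc cmap M] is [cmap Q \oc F (comma_top i)],
    where [cmap Q] splits and (P1) makes the other factor mono. *)
Lemma gorenstein_comma_mono (M : C) :
  gorenstein_projective M -> is_mono (cmap M).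
Proof.
move=> gM; have [Q [M' [i [p [pQ gM' /comma_short_exact[sT _]]]]]] :=
  gorenstein_up abC gM.
have mFi : is_mono (fmap F (comma_top i)).
  by apply: (perfect_mono gpc_top_up gpc_top_down _ sT); exists M'.
have [r er] := comma_projective_split pQ.
apply: (@mono_compr _ _ _ _ (comma_bot i)); rewrite comma_homE.
by apply: mono_comp => //; apply: split_mono er.
Qed.

Lemma gorenstein_comma_coker (M : C) K (c : mor (cbot M) K) :
  gorenstein_projective M -> is_cokernel (cmap M) c -> gorenstein_projective K.
Proof.
move=> gM cc; pose W (K : B) := exists (M : C) (c : mor (cbot M) K),
  gorenstein_projective M /\ is_cokernel (cmap M) c.
have Qmono (Q : C) : is_projective Q -> is_mono (cmap Q).
  by move=> /comma_projective_split[r er]; apply: split_mono er.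
apply: (@gorenstein_projective_splice _ _ W) => //; last by exists M, c.
- move=> {M K c gM cc} K [M [c [gM cc]]].
  have [Q [M' [i [p [pQ gM' s]]]]] := gorenstein_up abC gM.
  have [KQ [cQ ccQ]] := ab_cokernel abB (cmap Q).
  have [K' [c' cc']] := ab_cokernel abB (cmap M').
  have [k1 ek1] := coker_map i cc ccQ; have [k2 ek2] := coker_map p ccQ cc'.
  exists KQ, K', k1, k2; split.
  + exact: comma_projective_coker ccQ.
  + by exists M', c'.
  + apply: (coker_short_exact s cc ccQ cc' ek1 ek2 (Qmono _ pQ)).
    exact: gorenstein_comma_mono.
- move=> {M K c gM cc} K [M [c [gM cc]]].
  have [Q [M' [i [p [pQ gM' s]]]]] := gorenstein_down abC gM.
  have [KQ [cQ ccQ]] := ab_cokernel abB (cmap Q).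
  have [K' [c' cc']] := ab_cokernel abB (cmap M').
  have [k1 ek1] := coker_map i cc' ccQ; have [k2 ek2] := coker_map p ccQ cc.
  exists KQ, K', k1, k2; split.
  + exact: comma_projective_coker ccQ.
  + by exists M', c'.
  + apply: (coker_short_exact s cc' ccQ cc ek1 ek2 (Qmono _ pQ)).
    exact: gorenstein_comma_mono.
- move=> {M K c gM cc} K P [M [c [gM cc]]] pP.
  have [Q [M' [i [p [pQ gM' s]]]]] := gorenstein_down abC gM.
  have [KQ [cQ ccQ]] := ab_cokernel abB (cmap Q).
  have [K' [c' cc']] := ab_cokernel abB (cmap M').
  have [k1 ek1] := coker_map i cc' ccQ; have [k2 ek2] := coker_map p ccQ cc.
  have sk : short_exact k1 k2.
    apply: (coker_short_exact s cc' ccQ cc ek1 ek2 (Qmono _ pQ)).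
    exact: gorenstein_comma_mono.
  apply: (ext_vanish_cover abB (comma_projective_coker pQ ccQ) sk) => f.
  (* A map [K' -> P] is a morphism [M' -> (0, P)]; once extended to [Q], it factors through [KQ]. *)
  have [Z zZ] := ab_zero abA.
  have sq : (f \oc c') \oc cmap M' = (0 : mor (F Z) P) \oc fmap F 0.
    by rewrite mcomp0m -mcompA cc'.1 mcompm0.
  have pZ : is_projective (Comma (0 : mor (F Z) P) : C).
    exact: comma_projective_bot.
  have [g eg] := gorenstein_ext_projective abC gM pZ s
    (@comma_homI _ _ F M' (Comma (0 : mor (F Z) P)) 0 (f \oc c') sq).
  have /is_cokernelP[_ _ uQ] := ccQ.
  have [|h eh] := uQ _ (comma_bot g); first by rewrite comma_homE mcomp0m.
  exists h; apply: (cokernel_epi cc').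
  rewrite -mcompA ek1 mcompA eh.
  exact: (congr1 (@comma_bot _ _ F _ _) eg).
Qed.

Lemma gorenstein_comma_top (M : C) :
  gorenstein_projective M -> gorenstein_projective (ctop M).
Proof.
move=> gM.
apply: (gorenstein_projective_splice abA gpc_top_up gpc_top_down); last by exists M.
move=> {M gM} _ Q [M gM <-] pQ.
have [R [M' [i [p [pR gM' s]]]]] := gorenstein_down abC gM.
have [sT _] := (comma_short_exact _ _).1 s.
apply: (ext_vanish_cover abA (comma_projective_top pR) sT) => f.
have [K [c cc]] := ab_cokernel abB (cmap M').
(* Extending [F f] along [cmap M'] turns [f] into a morphism [M' -> (Q, FQ)]. *)
have [|b eb] := gp_ext_free (gorenstein_comma_coker gM' cc) pQ
    (u := cmap M') (v := c) _ (fmap F f).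
  by apply: mono_short_exact => //; apply: gorenstein_comma_mono.
have sq : b \oc cmap M' = idm (F Q) \oc fmap F f by rewrite mcomp1m.
have [g eg] := gorenstein_ext_projective abC gM (comma_projective_free pQ) s
  (@comma_homI _ _ F M' (Comma (idm (F Q))) f b sq).
by exists (comma_top g); apply: (congr1 (@comma_top _ _ F _ _) eg).
Qed.

(** * From (2) to (1) *)

Definition gorenstein_extension (M : C) :=
  [/\ is_mono (cmap M),
      exists (K : B) (c : mor (cbot M) K),
        is_cokernel (cmap M) c /\ gorenstein_projective K
    & gorenstein_projective (ctop M)].

Let gp_fmap_mono (Y U V : A) (u : mor U V) (v : mor V Y) :
  gorenstein_projective Y -> short_exact u v -> is_mono (fmap F u).
Proof. exact: perfect_mono (gorenstein_up abA) (gorenstein_down abA) Y U V u v. Qed.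

Lemma gorenstein_extension_up (M : C) : gorenstein_extension M ->
  exists Q M' (i : mor M Q) (p : mor Q M'),
    [/\ is_projective Q, gorenstein_extension M' & short_exact i p].
Proof.
move=> [mM [K [c [cc gK]]] gY].
have [R [Y' [i [p [pR gY' sip]]]]] := gorenstein_up abA gY.
have [P [K' [j [q [pP gK' sjq]]]]] := gorenstein_up abB gK.
have [S [i1 [i2 [p1 [p2 bS]]]]] := ab_biproduct abB (F R) P.
have [a ea] := gp_ext_free gK pR (mono_short_exact abB mM cc) (fmap F i).
have cp2 := biproduct_cokernel bS; case: (bS) => e11 e22 e21 e12 eS.
pose b := i1 \oc a + i2 \oc (j \oc c).
have sq : b \oc cmap M = i1 \oc fmap F i.
  by rewrite mcompDl -!mcompA ea cc.1 !mcompm0 addr0.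
pose N : C := Comma i1; pose f := @comma_homI _ _ F M N i b sq.
have p2b : p2 \oc b = j \oc c.
  by rewrite mcompDr !(compA e21, compA e22) mcomp0m mcomp1m add0r.
have mi := kernel_mono sip.1; have mj := kernel_mono sjq.1.
have mi1 : is_mono i1 by apply: split_mono e11.
(* If [b] kills [x], so does [j \oc c]; hence [x] comes from [F (ctop M)], where [b] restricts to
   the mono [i1 \oc F i]. *)
have mb : is_mono b.
  apply/monoP => T x bx; have /is_kernelP[_ _ uM] := mono_kernel_coker abB mM cc.
  have [|y ey] := uM _ x; first by apply: mj; rewrite mcompm0 mcompA -p2b -mcompA bx mcompm0.
  rewrite -ey (_ : y = 0) ?mcompm0 //; apply: (gp_fmap_mono gY' sip).
  apply: mi1; rewrite !mcompm0 mcompA -sq -mcompA ey.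
  exact: bx.
have [M' [g [gT gB]]] := comma_cokernel_ex abA abB rF f.
have sfg : short_exact f g.
  by apply/comma_short_exact; split; apply: mono_short_exact.
have [KM [cM ccM]] := ab_cokernel abB (cmap M').
have [k2 ek2] := coker_map g cp2 ccM.
have mM' : is_mono (cmap M').
  exact: (comma_quotient_mono sfg cc cp2 (esym p2b)).
have sk := coker_short_exact sfg cc cp2 ccM (esym p2b) ek2 mi1 mM'.
exists N, M', f, g; split=> //; first exact: (@comma_projective N P i2 p1 p2).
split=> //.
  exists KM, cM; split=> //; apply: gorenstein_isomorphic gK'.
  by have [s [t [ts st _ _]]] := cokernel_iso sk.2 sjq.2; exists s, t.
apply: gorenstein_isomorphic gY'.
by have [s [t [ts st _ _]]] := cokernel_iso gT sip.2; exists s, t.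
Qed.

Lemma gorenstein_extension_down (M : C) : gorenstein_extension M ->
  exists Q M' (i : mor M' Q) (p : mor Q M),
    [/\ is_projective Q, gorenstein_extension M' & short_exact i p].
Proof.
move=> [mM [K [c [cc gK]]] gY].
have [R [Y' [i [p [pR gY' sip]]]]] := gorenstein_down abA gY.
have [P [K' [j [q [pP gK' sjq]]]]] := gorenstein_down abB gK.
have [S [i1 [i2 [p1 [p2 bS]]]]] := ab_biproduct abB (F R) P.
have cp2 := biproduct_cokernel bS; case: (bS) => e11 e22 e21 e12 eS.
have [l el] := pP _ _ c (cokernel_epi cc) q.
pose b := cmap M \oc fmap F p \oc p1 + l \oc p2.
have sq : b \oc i1 = cmap M \oc fmap F p.
  by rewrite mcompDl -!mcompA e11 e21 !mcompm0 mcompm1 addr0.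
have bi2 : b \oc i2 = l by rewrite mcompDl -!mcompA e12 e22 !mcompm0 mcompm1 add0r.
have cb : q \oc p2 = c \oc b.
  by rewrite mcompDr !mcompA cc.1 !mcomp0m add0r el.
pose N : C := Comma i1; pose f := @comma_homI _ _ F N M p b sq.
have ep := cokernel_epi sip.2; have eq := cokernel_epi sjq.2.
have mi1 : is_mono i1 by apply: split_mono e11.
have eb : is_epi b.
  apply/epiP => T t tb; have /is_cokernelP[_ _ uc] := cc.
  have [|s es] := uc _ t.
    apply: (cokernel_epi (right_exact_cokernel abA abB rF sip.2)).
    by rewrite mcomp0m -mcompA -sq mcompA tb mcomp0m.
  rewrite -es (_ : s = 0) ?mcomp0m //; apply: eq.
  by rewrite mcomp0m -el mcompA es -bi2 mcompA tb mcomp0m.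
have [M' [k [kT kB]]] := comma_kernel_ex abA abB f.
have sT : short_exact (comma_top k) (comma_top f) by apply: epi_short_exact.
have skf : short_exact k f.
  by apply/comma_short_exact; split=> //; apply: epi_short_exact.
(* [comma_bot k \oc cmap M'] is [i1 \oc F (comma_top k)], whose second factor is mono because the
   top of [M] is Gorenstein projective. *)
have mM' : is_mono (cmap M').
  apply: (@mono_compr _ _ _ _ (comma_bot k)); rewrite comma_homE.
  by apply: mono_comp mi1 _; apply: gp_fmap_mono gY sT.
have [KM [cM ccM]] := ab_cokernel abB (cmap M').
have [k1 ek1] := coker_map k ccM cp2.
have sk := coker_short_exact skf ccM cp2 cc ek1 cb mi1 mM.
exists N, M', k, f; split=> //; first exact: (@comma_projective N P i2 p1 p2).
split=> //.
  exists KM, cM; split=> //; apply: gorenstein_isomorphic gK'.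
  by have [s [t [ts st _ _]]] := kernel_iso sk.1 sjq.1; exists s, t.
apply: gorenstein_isomorphic gY'.
by have [s [t [ts st _ _]]] := kernel_iso kT sip.1; exists s, t.
Qed.

(** The top component is extended first; a provisional bottom component, built from the retraction
    [r], is then corrected by a map through [cQ]. *)
Lemma gorenstein_extension_ext (M N : C) :
  gorenstein_extension M -> is_projective N -> ext_vanish M N.
Proof.
move=> wM pN; have [Q [M' [k [p [pQ wM' skp]]]]] := gorenstein_extension_down wM.
case: wM wM' => [mM [K [c [cc gK]]] gY] [mM' [K' [c' [cc' gK']]] gY'].
have [sT _] := (comma_short_exact _ _).1 skp.
have [KQ [cQ ccQ]] := ab_cokernel abB (cmap Q).
have [r er] := comma_projective_split pQ.
have [k1 ek1] := coker_map k cc' ccQ; have [k2 ek2] := coker_map p ccQ cc.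
have sk := coker_short_exact skp cc' ccQ cc ek1 ek2 (split_mono er) mM.
(* [cbot N] is the sum of [F (ctop N)], handled by (P2), and a projective cokernel. *)
have xN : ext_vanish K (cbot N).
  have [KN [cN ccN]] := ab_cokernel abB (cmap N).
  have [rN erN] := comma_projective_split pN.
  have [s bN] := split_biproduct erN ccN.
  apply: ext_vanish_biprod bN _ _.
    exact: gp_ext_free gK (comma_projective_top pN).
  exact: gorenstein_ext_projective gK (comma_projective_coker pN ccN).
apply: (ext_vanish_cover abC pQ skp) => f.
have [g1 eg1] := gorenstein_ext_projective abA gY (comma_projective_top pN) sT
  (comma_top f).
pose g0 := cmap N \oc fmap F g1 \oc r.
have g0Q : g0 \oc cmap Q = cmap N \oc fmap F g1 by rewrite -mcompA er mcompm1.
have /is_cokernelP[_ _ uc'] := cc'.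
(* The error of [g0] vanishes on [cmap M'], so it is a map [h] from [K'], which [xN] extends along
   [k1]. *)
have [|h eh] := uc' _ (comma_bot f - g0 \oc comma_bot k).
  rewrite mcompBl -mcompA !comma_homE mcompA g0Q -mcompA -fmap_comp eg1.
  by rewrite subrr.
have [h' eh'] := xN _ _ _ _ sk h.
have sq : (g0 + h' \oc cQ) \oc cmap Q = cmap N \oc fmap F g1.
  by rewrite mcompDl g0Q -mcompA ccQ.1 mcompm0 addr0.
exists (@comma_homI _ _ F Q N g1 _ sq); apply: comma_hom_eq => //=.
by rewrite mcompDl -mcompA -ek1 mcompA eh' eh addrC subrK.
Qed.

End Perfect.

Theorem theorem1p1 (A B : abelian_category) (F : additive_functor A B)
    (rF : right_exact F) (pF : perfect F)
    (Y : A) (X : B) (phi : mor (F Y) X) :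
  gorenstein_projective (Comma phi) <->
  [/\ is_mono phi,
      (exists (K : B) (c : mor X K),
         is_cokernel phi c /\ gorenstein_projective K)
    & gorenstein_projective Y].
Proof.
have abA := abelianP A; have abB := abelianP B; split=> [gM|wM].
  split; first exact: (gorenstein_comma_mono abA abB rF pF gM).
    have [K [c cc]] := ab_cokernel abB phi; exists K, c; split=> //.
    exact: (gorenstein_comma_coker abA abB rF pF gM cc).
  exact: (gorenstein_comma_top abA abB rF pF gM).
apply: (gorenstein_projective_splice (comma_is_abelian abA abB rF)
  (W := @gorenstein_extension A B F)) => //.
- exact: gorenstein_extension_up.
- exact: gorenstein_extension_down.
- by move=> M P wM' pP; apply: gorenstein_extension_ext.
Qed.
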